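(* Let $W$ be a Coxeter group with simple generators $S$ and let $\Omega$ be an orientation of its Coxeter diagram $\Gamma$. The map $\pi_\downarrow^{\Omega}:W\to W$ is idempotent, i.e. $\pi_\downarrow^\Omega\circ\pi_\downarrow^\Omega=\pi_\downarrow^\Omega$.
   Context: $W$ is a Coxeter group with finite set $S$ of simple generators; $\ell$ is the length function and $e$ the identity. The (right) weak order on $W$ sets $u\le w$ if and only if $\ell(u)+\ell(u^{-1}w)=\ell(w)$. For $J\subseteq S$, $W_J$ is the standard parabolic subgroup generated by $J$. The Coxeter diagram $\Gamma$ is the graph with vertex set $S$ in which distinct $s,t$ are joined by an edge if and only if they do not commute. $\Omega$ is an arbitrary orientation of $\Gamma$ (each edge is given one direction; directed cycles are allowed). A subset $J\subseteq S$ is $\Omega$-acyclic if the induced subgraph of $\Gamma$ on $J$, oriented by $\Omega$, has no directed cycle. For $\Omega$-acyclic $J$, $c(\Omega,J)=s_1s_2\cdots s_k$, where $s_1,\ldots,s_k$ is any ordering of $J$ such that $i<j$ whenever there is an edge oriented $s_j\to s_i$ (the product does not depend on the ordering; $c(\Omega,\emptyset)=e$). $J(w,\Omega)$ denotes the unique maximal (under inclusion) element among the $\Omega$-acyclic subsets $J'\subseteq S$ with $w\ge c(\Omega,J')$ (it is a fact that there is a unique maximal one, which therefore contains all the others). For $w\in W$, $\mathrm{inv}(w)$ is the set of reflections $t$ (conjugates of elements of $S$) with $\ell(tw)<\ell(w)$. For $J\subseteq S$, $w_J$ is the unique element of $W_J$ with $\mathrm{inv}(w_J)=\mathrm{inv}(w)\cap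 W_J$. The map $\pi_\downarrow^\Omega:W\to W$ is defined recursively by $\pi_\downarrow^\Omega(e)=e$ and, for $w\neq e$, with $J=J(w,\Omega)$, $\pi_\downarrow^{\Omega}(w)=c(\Omega,J)\,\pi_\downarrow^{\Omega}\bigl(c(\Omega,J)^{-1}w_J\bigr)$. *)

(* Defs.v *)
From HB Require Import structures.
From mathcomp Require Import all_boot.
From mathcomp Require Import boolp classical_sets.

Set Implicit Arguments.
Unset Strict Implicit.
Unset Printing Implicit Defensive.

Local Open Scope group_scope.

(* The congruence on words in [S] generated by the Coxeter relations
   (s t)^(m s t) = 1.  The value [m s t = 0] encodes infinite order: the
   relator is then the empty word.  Since [m s s = 1] gives s s = 1, formal
   inverses are not needed, and the monoid so presented is the Coxeter group. *)
Inductive coxeter_cong (S : Type) (m : S -> S -> nat) : seq S -> seq S -> Prop :=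
| coxeter_cong_refl u : coxeter_cong m u u
| coxeter_cong_sym u v : coxeter_cong m u v -> coxeter_cong m v u
| coxeter_cong_trans u v w :
    coxeter_cong m u v -> coxeter_cong m v w -> coxeter_cong m u w
| coxeter_cong_rel u v s t :
    coxeter_cong m (u ++ flatten (nseq (m s t) [:: s; t]) ++ v) (u ++ v).

Record coxeter_system := CoxeterSystem {
  cox_group :> groupType;
  cox_gen : finType;
  simple : cox_gen -> cox_group;
  cox_matrix : cox_gen -> cox_gen -> nat;
  cox_matrix_sym : forall s t, cox_matrix s t = cox_matrix t s;
  cox_matrix_eq1 : forall s t, (cox_matrix s t == 1%N) = (s == t);
  cox_generation : forall w : cox_group,
    exists u : seq cox_gen, \prod_(s <- u) simple s = w;
  cox_presentation : forall u v : seq cox_gen,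
    \prod_(s <- u) simple s = \prod_(s <- v) simple s
    <-> coxeter_cong cox_matrix u v
}.

Section Defs.

Variable W : coxeter_system.
Notation S := (cox_gen W).
Implicit Types (w u v x : W) (s t : S) (J : {set S}).

Definition word_prod (l : seq S) : W := \prod_(s <- l) simple s.

Lemma ex_word_of_size w :
  exists n, [exists l : n.-tuple S, word_prod l == w].
Proof.
have [l lw] := cox_generation w.
by exists (size l); apply/existsP; exists (in_tuple l); apply/eqP.
Qed.

Definition length w : nat := ex_minn (ex_word_of_size w).

Definition weak_le u w : bool := (length u + length (u^-1 * w) == length w)%N.

Definition is_reflection x : Prop := exists v s, x = v * simple s * v^-1.

Definition inversions w : set W :=
  fun x => is_reflection x /\ (length (x * w) < length w)%N.

Definition parabolic J : set W :=
  smallest (fun H : set W => group_closed (mem H))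
           (fun x => exists2 s, s \in J & x = simple s).

Definition parabolic_part J w : W :=
  xget 1 (fun v => parabolic J v /\
                   inversions v = (inversions w `&` parabolic J)%classic).

Definition diagram : rel S := fun s t =>
  (s != t) && (simple s * simple t != simple t * simple s).

(* [Omega s t] means that the edge between [s] and [t] is oriented s -> t. *)
Definition orientation (Omega : rel S) : Prop :=
  (forall s t, diagram s t = Omega s t || Omega t s) /\
  (forall s t, ~~ (Omega s t && Omega t s)).

Variable Omega : rel S.

Definition acyclic J : Prop :=
  forall c : seq S, c != [::] -> {subset c <= J} -> ~~ ucycleb Omega c.

Definition admissible_ordering J (l : seq S) : Prop :=
  [/\ uniq l, l =i J &
      {in J &, forall s t, Omega t s -> (index s l < index t l)%N}].

(* Meaningful only for acyclic [J]: every admissible ordering then has the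
   same product, and one exists. *)
Definition cox_elt J : W := word_prod (xget [::] (admissible_ordering J)).

(* An inclusion-maximal set always exists ([set0] qualifies), and it is unique
   when [Omega] is an orientation of the diagram. *)
Definition max_acyclic w : {set S} :=
  xget finset.set0 (fun J =>
    maxset (fun J' => `[< acyclic J' >] && weak_le (cox_elt J') w) J).

(* The recursion is on [length w]: for [w != 1] the element [c] is nontrivial
   and below [parabolic_part J w] in the weak order, so
   length (c^-1 * parabolic_part J w) < length w.  The bound [n] is therefore
   never exhausted before the argument becomes 1 when [n >= length w]. *)
Fixpoint pi_down_rec (n : nat) w : W :=
  if n is n'.+1 then
    if w == 1 then 1 else
    let J := max_acyclic w in
    let c := cox_elt J in
    c * pi_down_rec n' (c^-1 * parabolic_part J w)
  else 1.

Definition pi_down w : W := pi_down_rec (length w) w.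

End Defs.

(* Main.v *)
Require Import Defs.
From mathcomp Require Import all_boot all_algebra all_field ring.
From mathcomp Require Import boolp classical_sets.

Set Implicit Arguments.
Unset Strict Implicit.
Unset Printing Implicit Defensive.

(** Write c = c(Omega, J) with J = J(w, Omega), and let x = c^-1 w_J, so that
    pi(w) = c pi(x).

    The recursion only moves down the weak order: pi(w) <= w.  Indeed
    pi(x) <= x by induction; since c <= w_J = c x, the lengths of c and x add
    up, so left multiplication by c preserves the relation pi(x) <= x, and
    c <= c pi(x) <= c x = w_J <= w ([weak_le_mull], [pi_down_le]).

    Set v = pi(w) = c pi(x).  From v <= w_J it follows that v lies in W_J, hence
    every acyclic J' with c(Omega, J') <= v is contained in J; as c <= v, the
    set J itself qualifies and J(v, Omega) = J.  Moreover v_J = v, so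
    pi(v) = c pi(c^-1 v) = c pi(pi(x)) = c pi(x) = v by induction
    ([pi_down_idem]).

    The rest of the file derives from the presentation of W the facts used here.
    - The exchange property and the description of the weak order by inclusion
      of inversion sets come from a parity count: the number of times a
      reflection t occurs in the sequence of reflections attached to a word is,
      modulo 2, constant on Coxeter congruence classes, and its value tells
      whether t shortens the element ([shortens_word]).
    - That c(Omega, J') in W_J forces J' to be contained in J needs that
      distinct elements of S stay distinct in W, which is obtained from a linear
      representation over the algebraic numbers ([simple_inj]).
    - The element w_J is w x^-1, where x is the shortest element of the coset
      W_J w ([parabolic_partP]). *)

(** * Words in the simple generators *)

Section Words.
Local Open Scope group_scope.
Variable W : coxeter_system.
Notation S := (cox_gen W).
Implicit Types (u v w x t : W) (s r : S) (l : seq S).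

Lemma word_prod_nil : word_prod ([::] : seq S) = 1.
Proof. by rewrite /word_prod big_nil. Qed.

Lemma word_prod_cons s l : word_prod (s :: l) = simple s * word_prod l.
Proof. by rewrite /word_prod big_cons. Qed.

Lemma word_prod_cat l1 l2 : word_prod (l1 ++ l2) = word_prod l1 * word_prod l2.
Proof. by rewrite /word_prod big_cat. Qed.

Lemma word_prod_seq1 s : word_prod [:: s] = simple s.
Proof. by rewrite word_prod_cons word_prod_nil mulg1. Qed.

Lemma word_prod_alternating s r k :
  word_prod (flatten (nseq k [:: s; r])) = (simple s * simple r) ^+ k.
Proof.
elim: k => [|k IHk] /=; first by rewrite word_prod_nil.
by rewrite !word_prod_cons IHk expgS mulgA.
Qed.

Lemma coxeter_relation s r : (simple s * simple r) ^+ cox_matrix s r = 1.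
Proof.
rewrite -word_prod_alternating -word_prod_nil; apply/cox_presentation.
by have := coxeter_cong_rel (@cox_matrix W) [::] [::] s r; rewrite cats0.
Qed.

Lemma simpleK s : simple s * simple s = 1.
Proof.
have := coxeter_relation s s.
by have /eqP -> : (cox_matrix s s == 1)%N by rewrite cox_matrix_eq1.
Qed.

Lemma simpleV s : (simple s)^-1 = simple s.
Proof. by apply: mulg1_eq; exact: simpleK. Qed.

Lemma simpleKl s x : simple s * (simple s * x) = x.
Proof. by rewrite mulgA simpleK mul1g. Qed.

Lemma word_prod_rev l : word_prod (rev l) = (word_prod l)^-1.
Proof.
elim: l => [|s l IHl]; first by rewrite /rev /= word_prod_nil invg1.
by rewrite rev_cons -cats1 word_prod_cat IHl word_prod_seq1 word_prod_cons
           invgM simpleV.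
Qed.

End Words.

(** * Distinct generators are distinct in the group *)

Section Representation.
Import GRing.Theory Num.Theory.
Local Open Scope ring_scope.

Section Operators.
Variables (I : finType) (K : fieldType) (a : I -> I -> K).

(** The contragredient of the reflection e_r |-> e_r + a_(s,r) e_s, acting on
    coordinate functions. *)
Definition reflect_along (s : I) (f : {ffun I -> K}) : {ffun I -> K} :=
  [ffun r => f r + a s r * f s].

Lemma reflect_along_invol s f :
  a s s = - 2 -> reflect_along s (reflect_along s f) = f.
Proof. by move=> ass; apply/ffunP => r; rewrite !ffunE ass; ring. Qed.

(** The product of the two reflections only adds multiples of the rows [a s] and
    [a t], so its powers are controlled by the pair (f s, f t).  On that pair it
    acts with eigenvalues z and z^-1, the eigenforms being f s + z f t and
    f s + f t.  The multiples added by the m-th power are geometric sums of z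
    and z^-1, which vanish because z is a nontrivial m-th root of unity. *)
Lemma rotation_order (s t : I) (z : K) m :
  a s s = - 2 -> a t t = - 2 -> a t s = 1 + z -> a s t = 1 + z^-1 ->
  z != 0 -> z != 1 -> z ^+ m = 1 ->
  forall f, iter m (fun g => reflect_along s (reflect_along t g)) f = f.
Proof.
move=> ass att ats ast z0 z1 zm f.
pose F k := iter k (fun g => reflect_along s (reflect_along t g)) f.
rewrite -/(F m).
pose A := f s + z * f t; pose B := f s + f t.
have FS k r : F k.+1 r = F k r + a t r * F k t +
                          a s r * (F k s + (1 + z) * F k t).
  by rewrite /F /= !ffunE ats; ring.
(* The pair (F k s, F k t) in the eigenbasis. *)
have eigen k : F k s + z * F k t = z ^+ k * A /\
               F k s + F k t = z^-1 ^+ k * B.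
  elim: k => [|k [IH1 IH2]]; first by rewrite !expr0 !mul1r.
  rewrite !FS !exprS -!mulrA -IH1 -IH2 ass att ats ast.
  by split; field.
have sum_powers (x : K) : x != 1 -> x ^+ m = 1 -> \sum_(i < m) x ^+ i = 0.
  move=> x1 xm; have := subrX1 x m; rewrite xm subrr => /esym/eqP.
  by rewrite mulf_eq0 subr_eq0 (negPf x1) => /eqP.
have zV1 : z^-1 != 1 by rewrite invr_eq1.
have zVm : z^-1 ^+ m = 1 by rewrite exprVn zm invr1.
have sum_t : \sum_(i < m) F i t = 0.
  apply: (mulfI (x := z - 1)); first by rewrite subr_eq0.
  rewrite mulr0 mulr_sumr.
  have -> : \sum_(i < m) (z - 1) * F i t =
            \sum_(i < m) z ^+ i * A - \sum_(i < m) z^-1 ^+ i * B.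
    rewrite -sumrB; apply: eq_bigr => i _.
    by have [<- <-] := eigen i; ring.
  by rewrite -!mulr_suml !sum_powers // !mul0r subrr.
have sum_s : \sum_(i < m) F i s = 0.
  have : \sum_(i < m) z^-1 ^+ i * B = 0.
    by rewrite -mulr_suml sum_powers ?mul0r.
  rewrite (eq_bigr (fun i : 'I_m => F i s + F i t)).
    by rewrite big_split /= sum_t addr0.
  by move=> i _; have [_ <-] := eigen i.
have closed k r : F k r = f r + a t r * (\sum_(i < k) F i t) +
    a s r * (\sum_(i < k) F i s + (1 + z) * \sum_(i < k) F i t).
  elim: k => [|k IHk]; first by rewrite !big_ord0 /F /=; ring.
  by rewrite FS !big_ord_recr /= IHk; ring.
by apply/ffunP => r; rewrite closed sum_t sum_s; ring.
Qed.

End Operators.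

(** In the representation attached to a generalized Cartan matrix, the
    generator s negates the coordinate s of the delta function at s, whereas any
    other generator fixes that coordinate.  The usual entries -2 cos (pi / m)
    are replaced by 1 + z and 1 + z^-1 with z a primitive m-th root of unity:
    their product 2 + z + z^-1 is the same as 4 cos^2 (pi / m) up to Galois
    conjugation, and no square root is needed.  Which of the two entries gets z
    is decided by an arbitrary total order on S. *)
Lemma simple_inj (W : coxeter_system) : injective (@simple W).
Proof.
move=> s t est; apply/eqP/negPn/negP => nst.
have [z zP] : exists z : nat -> algC,
    forall n, (0 < n)%N -> n.-primitive_root (z n).
  pose z n := if (0 < n)%N =P true is ReflectT n_gt0
    then sval (C_prim_root_exists n_gt0) else 0.
  exists z => n n_gt0; rewrite /z; case: eqP => // e.
  exact: svalP (C_prim_root_exists e).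
pose a (p q : cox_gen W) : algC := if p == q then - 2 else
  if (enum_rank p < enum_rank q)%N then 1 + z (cox_matrix p q)
  else 1 + (z (cox_matrix p q))^-1.
pose act l f := foldr (reflect_along a) f l.
have diag p : a p p = - 2 by rewrite /a eqxx.
have rel p q f : act (flatten (nseq (cox_matrix p q) [:: p; q])) f = f.
  have -> : forall k, act (flatten (nseq k [:: p; q])) f =
    iter k (fun g => reflect_along a p (reflect_along a q g)) f.
    by elim=> //= k ->.
  case: (eqVneq p q) => [<-|npq].
    have /eqP -> : (cox_matrix p p == 1)%N by rewrite cox_matrix_eq1.
    by rewrite /= reflect_along_invol.
  case: (posnP (cox_matrix p q)) => [->//|m_gt0].
  have zprim := zP _ m_gt0.
  set m := cox_matrix p q in m_gt0 zprim *.
  have zm := prim_expr_order zprim.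
  have z0 : z m != 0.
    apply/eqP => z0; move/eqP: zm; rewrite z0 expr0n.
    by rewrite eqn0Ngt m_gt0 eq_sym oner_eq0.
  have z1 : z m != 1.
    have := prim_order_dvd zprim 1; rewrite expr1 dvdn1 => <-.
    by rewrite cox_matrix_eq1 (negPf npq).
  have amqp : cox_matrix q p = m by rewrite cox_matrix_sym.
  case: (ltngtP (enum_rank p) (enum_rank q)) => [lt|lt|e].
  - apply: (rotation_order (z := (z m)^-1)) => //;
      rewrite ?invr_eq0 ?invr_eq1 //.
    + by rewrite /a eq_sym (negPf npq) ltnNge ltnW //= amqp.
    + by rewrite /a (negPf npq) lt invrK.
    + by rewrite exprVn zm invr1.
  - apply: (rotation_order (z := z m)) => //.
    + by rewrite /a eq_sym (negPf npq) lt amqp.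
    + by rewrite /a (negPf npq) ltnNge ltnW.
  - by move/val_inj/enum_rank_inj: e npq => ->; rewrite eqxx.
have act_cong u v : coxeter_cong (@cox_matrix W) u v ->
    forall f, act u f = act v f.
  elim=> {u v} [//|u v _ IH f|u v w _ IH1 _ IH2 f|u v p q f].
  - by rewrite IH.
  - by rewrite IH1.
  - by rewrite /act !foldr_cat; congr (foldr _ _ _); exact: rel.
have /act_cong/(_ [ffun r => (r == s)%:R])/ffunP/(_ s) :
    coxeter_cong (@cox_matrix W) [:: s] [:: t].
  by apply/cox_presentation; rewrite !big_cons est.
rewrite !ffunE !eqxx eq_sym (negPf nst) diag mulr1 mulr0 addr0 => /eqP.
rewrite -subr_eq0.
have -> : 1 - 2 - 1 = - 2%:R :> algC by ring.
by rewrite oppr_eq0 pnatr_eq0.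
Qed.

End Representation.

(** * Length, exchange property and weak order *)

Section Exchange.
Local Open Scope group_scope.
Variable W : coxeter_system.
Notation S := (cox_gen W).
Implicit Types (u v w x t : W) (s r : S) (l : seq S).

Lemma length_word_prod l : (length (word_prod l) <= size l)%N.
Proof.
rewrite /length; case: ex_minnP => n _; apply.
by apply/existsP; exists (in_tuple l).
Qed.

Lemma reduced_word w : exists2 l, word_prod l = w & size l = length w.
Proof.
rewrite /length; case: ex_minnP => n /existsP[l /eqP lw] _.
by exists l; rewrite ?size_tuple.
Qed.

Lemma length1 : length (1 : W) = 0%N.
Proof. by apply/eqP; rewrite -leqn0 -(word_prod_nil W) length_word_prod. Qed.

Lemma length_eq0 w : length w = 0%N -> w = 1.
Proof.
by have [l <- <-] := reduced_word w; move/size0nil->; rewrite word_prod_nil.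
Qed.

Lemma lengthM u v : (length (u * v) <= length u + length v)%N.
Proof.
have [lu <- <-] := reduced_word u; have [lv <- <-] := reduced_word v.
by rewrite -word_prod_cat -size_cat length_word_prod.
Qed.

Lemma length_simple_le s : (length (simple s) <= 1)%N.
Proof. by rewrite -word_prod_seq1 length_word_prod. Qed.

(** The word s_1 ... s_k has the attached reflections
    t_i = s_1 ... s_(i-1) s_i s_(i-1) ... s_1; this is the parity of the number
    of indices i with t_i = t. *)
Fixpoint word_parity l t : bool :=
  if l is s :: l' then (t == simple s) (+) word_parity l' (t ^ simple s)
  else false.

Lemma word_parity_cat l1 l2 t :
  word_parity (l1 ++ l2) t =
  word_parity l1 t (+) word_parity l2 (t ^ word_prod l1).
Proof.
elim: l1 t => [|s l IHl] t /=; first by rewrite word_prod_nil conjg1.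
by rewrite IHl word_prod_cons conjgM addbA.
Qed.

Lemma conjg_eq x y z : (x ^ z == y) = (x == y ^ z^-1).
Proof. by apply/eqP/eqP => [<-|->]; rewrite ?conjgK ?conjgKV. Qed.

Lemma word_parity_alternating s r k t :
  word_parity (flatten (nseq k [:: s; r])) t =
  \big[addb/false]_(0 <= i < k.*2)
     (t == (simple s * simple r) ^+ i * simple s).
Proof.
elim: k t => [|k IHk] t; first by rewrite big_nil.
rewrite doubleS big_nat_recl // big_nat_recl //= IHk.
rewrite expg0 mul1g expg1; congr (_ (+) (_ (+) _)).
  by rewrite conjg_eq conjgE !simpleV mulgA.
apply: eq_bigr => i _; rewrite -conjgM conjg_eq; congr (_ == _).
rewrite conjgE invgK [(_ * _)^-1]invgM !simpleV.
by rewrite expgS expgSr !mulgA.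
Qed.

(** The reflections attached to the relator (s r)^m are (s r)^i s for i < 2m.
    Since (s r)^m = 1 the second half of this list repeats the first. *)
Lemma word_parity_relation s r t :
  word_parity (flatten (nseq (cox_matrix s r) [:: s; r])) t = false.
Proof.
rewrite word_parity_alternating -addnn.
set m := cox_matrix s r.
rewrite (big_cat_nat (n := m)) ?leq_addr //=.
rewrite -{2}[m]addn0 addnC big_addn addnK.
rewrite [X in _ (+) X](eq_bigr
  (fun i => t == (simple s * simple r) ^+ i * simple s)) ?addbb //.
by move=> i _; rewrite expgnDr coxeter_relation mulg1.
Qed.

(** Hence the parity depends on the group element only. *)
Lemma word_parity_eq l1 l2 t :
  word_prod l1 = word_prod l2 -> word_parity l1 t = word_parity l2 t.
Proof.
move/cox_presentation=> c; elim: c t => {l1 l2}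
  [//|u v _ IH t|u v w _ IH1 _ IH2 t|u v s r t].
- by rewrite IH.
- by rewrite IH1.
rewrite !word_parity_cat word_parity_relation word_prod_alternating.
by rewrite coxeter_relation conjg1.
Qed.

(** If t is the reflection t_i attached to the word, then multiplying by t on
    the left erases the letter s_i. *)
Lemma word_parity_deletion l t : word_parity l t ->
  exists l1 s l2, l = l1 ++ s :: l2 /\ t * word_prod l = word_prod (l1 ++ l2).
Proof.
elim: l t => [|s l IHl] t //=; case: (eqVneq t (simple s)) => [-> _|_ /=].
  by exists [::], s, l; rewrite word_prod_cons simpleKl.
move=> /IHl[l1 [r [l2 [-> E]]]]; exists (s :: l1), r, l2; split=> //.
rewrite !word_prod_cons in E *; rewrite -E conjgE simpleV.
by rewrite -!mulgA simpleKl.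
Qed.

(** For t = v s v^-1, in the word l s l^-1 the occurrences of t coming from l
    and from l^-1 have the same parity, because l l^-1 is congruent to the empty
    word; the middle letter contributes the remaining one. *)
Lemma reflection_word t : is_reflection t ->
  exists2 l, word_prod l = t & word_parity l t.
Proof.
case=> v [s ->]; have [l lv _] := reduced_word v.
have vs : (v * simple s * v^-1) ^ v = simple s.
  by rewrite conjgE -!mulgA mulVg mulg1 mulKg.
exists (l ++ [:: s] ++ rev l).
  by rewrite !word_prod_cat word_prod_seq1 word_prod_rev lv mulgA.
have : word_parity (l ++ rev l) (v * simple s * v^-1) =
       word_parity [::] (v * simple s * v^-1).
  apply: word_parity_eq.
  by rewrite word_prod_cat word_prod_rev mulgV word_prod_nil.
rewrite !word_parity_cat lv vs /= eqxx word_prod_seq1.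
rewrite [simple s ^ _]conjgE simpleK mulg1 simpleV.
by case: word_parity; case: word_parity.
Qed.

Lemma reflectionK t : is_reflection t -> t * t = 1.
Proof.
by case=> v [s ->]; rewrite -!mulgA mulKg simpleKl mulgV.
Qed.

Lemma reflectionJ t w : is_reflection t -> is_reflection (t ^ w).
Proof.
case=> v [s ->]; exists (w^-1 * v), s.
by rewrite conjgE invgM invgK !mulgA.
Qed.

Lemma simple_reflection s : is_reflection (simple s).
Proof. by exists 1, s; rewrite invg1 mul1g mulg1. Qed.

(** For a reflection t this is membership in [inversions w]. *)
Definition shortens t w : bool := (length (t * w) < length w)%N.

(** An odd parity gives a shorter word for t w by deletion.  If the parity is
    even at w, it is odd at t w, so that w = t (t w) is shorter than t w. *)
Lemma shortens_word t l : is_reflection t ->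
  shortens t (word_prod l) = word_parity l t.
Proof.
have parity_shortens x w k :
    word_prod k = w -> word_parity k x -> shortens x w.
  have [l0 l0w l0len] := reduced_word w.
  move=> kw; rewrite (word_parity_eq (l2 := l0)) ?kw //.
  move=> /word_parity_deletion[l1 [s [l2 [El E]]]].
  rewrite /shortens -l0len -l0w E.
  by rewrite (leq_ltn_trans (length_word_prod _)) // El !size_cat /= addnS.
move=> tR; case: (boolP (word_parity l t)) => [/parity_shortens->//|Npar].
apply/negbTE; rewrite -leqNgt ltnW //.
have [lt ltE ltpar] := reflection_word tR.
have : shortens t (t * word_prod l).
  apply: (parity_shortens _ _ (lt ++ l)); first by rewrite word_prod_cat ltE.
  by rewrite word_parity_cat ltpar ltE conjgE mulKg (negPf Npar).
by rewrite /shortens mulgA reflectionK // mul1g.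
Qed.

(** The cocycle property, to which all later arguments about inversions are
    reduced. *)
Lemma shortensM t u v : is_reflection t ->
  shortens t (u * v) = shortens t u (+) shortens (t ^ u) v.
Proof.
move=> tR; have [lu <- _] := reduced_word u; have [lv <- _] := reduced_word v.
rewrite -word_prod_cat !shortens_word ?word_parity_cat //.
exact: reflectionJ.
Qed.

Lemma shortens_simple t s : is_reflection t ->
  shortens t (simple s) = (t == simple s).
Proof.
by move=> tR; rewrite -word_prod_seq1 shortens_word //= addbF word_prod_seq1.
Qed.

Lemma length_simple s : length (simple s) = 1%N.
Proof.
apply/eqP; rewrite eqn_leq length_simple_le /=.
have : shortens (simple s) (simple s).
  by rewrite shortens_simple ?eqxx //; apply: simple_reflection.
by rewrite /shortens simpleK length1.
Qed.

Lemma shortens_simpleM s w :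
  shortens (simple s) (simple s * w) = ~~ shortens (simple s) w.
Proof.
have sR := simple_reflection s.
by rewrite shortensM // shortens_simple // eqxx conjgE simpleV simpleK mulg1.
Qed.

Lemma length_simpleM s w :
  ~~ shortens (simple s) w -> length (simple s * w) = (length w).+1.
Proof.
rewrite -shortens_simpleM /shortens simpleKl => lt.
by apply/eqP; rewrite eqn_leq lt andbT -add1n -(length_simple s) lengthM.
Qed.

Lemma length_shortens s w :
  shortens (simple s) w -> length w = (length (simple s * w)).+1.
Proof.
move=> sw; rewrite -{1}[w](simpleKl s) length_simpleM //.
by rewrite shortens_simpleM sw.
Qed.

Lemma shortens_exists w : w != 1 -> exists s, shortens (simple s) w.
Proof.
have [[|s l] lw lenl] := reduced_word w.
  by rewrite -lw word_prod_nil eqxx.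
move=> _; exists s.
by rewrite /shortens -lenl -lw word_prod_cons simpleKl ltnS length_word_prod.
Qed.

Lemma weak_le_shortens u w t : weak_le u w -> shortens t u -> shortens t w.
Proof.
move=> /eqP uw; rewrite /shortens -uw => tu.
have {1}-> : w = u * (u^-1 * w) by rewrite mulVKg.
by rewrite mulgA (leq_ltn_trans (lengthM _ _)) // ltn_add2r.
Qed.

(** Induction on u: a first letter s of u is an inversion of u, hence of w, and
    by the cocycle property the inclusion of inversions passes to s u and
    s w. *)
Lemma shortens_weak_le u w :
  (forall t, is_reflection t -> shortens t u -> shortens t w) -> weak_le u w.
Proof.
move: {2}(length u) (erefl (length u)) => n; elim: n u w => [|n IHn] u w un sub.
  by rewrite (length_eq0 un) /weak_le length1 invg1 mul1g.
have [s su] : exists s, shortens (simple s) u.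
  by apply: shortens_exists; apply: contra_eq_neq un => ->; rewrite length1.
have sw := sub _ (simple_reflection s) su.
have lu := length_shortens su; have lw := length_shortens sw.
have /eqP : weak_le (simple s * u) (simple s * w).
  apply: IHn => [|t tR tsu]; first by rewrite un in lu; case: lu.
  have := sub _ (reflectionJ (simple s) tR).
  move: tsu; rewrite !shortensM //.
  rewrite !shortens_simple //.
  case: eqVneq => [->|_ /= tu /(_ tu)//]; rewrite conjgE simpleV simpleK mulg1.
  by rewrite su.
rewrite /weak_le invgM simpleV -mulgA simpleKl lu lw => <-.
by rewrite addSn.
Qed.

Lemma weak_le_trans v u w : weak_le u v -> weak_le v w -> weak_le u w.
Proof.
move=> uv vw; apply: shortens_weak_le => t _ /(weak_le_shortens uv).
exact: weak_le_shortens.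
Qed.

Lemma weak_le_refl w : weak_le w w.
Proof. by rewrite /weak_le mulVg length1 addn0. Qed.

Lemma weak_le_length u w : weak_le u w -> (length u <= length w)%N.
Proof. by move/eqP<-; rewrite leq_addr. Qed.

Lemma weak_le_anti u w : weak_le u w -> weak_le w u -> u = w.
Proof.
move=> uw /weak_le_length wu; have := uw; rewrite /weak_le => /eqP e.
have /length_eq0/mulg1_eq : length (u^-1 * w) = 0%N.
  by apply/eqP; rewrite -leqn0 -(leq_add2l (length u)) e addn0.
by rewrite invgK.
Qed.

(** The chain l(c v) <= l(c u) + l(u^-1 v) <= l(c) + l(u) + l(u^-1 v)
    = l(c) + l(v) starts and ends with the same number, so it consists of
    equalities. *)
Lemma weak_le_mull c u v :
  weak_le c (c * v) -> weak_le u v ->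
  weak_le c (c * u) /\ weak_le (c * u) (c * v).
Proof.
rewrite /weak_le !mulKg invgM -mulgA mulKg => /eqP cv /eqP uv.
have le1 := lengthM c u; have := lengthM (c * u) (u^-1 * v).
rewrite mulgA mulgK -cv -uv addnA leq_add2r => le2.
have -> : length (c * u) = (length c + length u)%N.
  by apply/eqP; rewrite eqn_leq le1.
by rewrite eqxx -addnA uv cv eqxx.
Qed.

End Exchange.

(** * Standard parabolic subgroups *)

Section Parabolic.
Local Open Scope group_scope.
Variable W : coxeter_system.
Notation S := (cox_gen W).
Implicit Types (u v w x t : W) (s r : S) (l : seq S) (J : {set S}).

Lemma parabolicP J w :
  parabolic J w <-> exists2 l, {subset l <= J} & word_prod l = w.
Proof.
split.
  apply: (@smallest_sub _ _ _
            (fun w => exists2 l, {subset l <= J} & word_prod l = w)).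
    split; first by apply/asboolP; exists [::]; rewrite ?word_prod_nil.
    move=> _ _ /asboolP[lx lxJ <-] /asboolP[ly lyJ <-]; apply/asboolP.
    exists (lx ++ rev ly); last by rewrite word_prod_cat word_prod_rev.
    by move=> s; rewrite mem_cat mem_rev => /orP[/lxJ|/lyJ].
  move=> _ [s sJ ->]; exists [:: s]; rewrite ?word_prod_seq1 //.
  by move=> r; rewrite inE => /eqP->.
move=> [l lJ <-] H [Hgrp HJ]; elim: l lJ => [|s l IHl] lJ.
  by rewrite word_prod_nil; case: Hgrp => /asboolP.
rewrite word_prod_cons; apply/asboolP; apply: (group_closedM Hgrp).
  by apply/asboolP; apply: HJ; exists s => //; apply: lJ; rewrite mem_head.
by apply/asboolP; apply: IHl => r rl; apply: lJ; rewrite inE rl orbT.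
Qed.

Lemma parabolic1 J : parabolic J 1.
Proof. by apply/parabolicP; exists [::]; rewrite ?word_prod_nil. Qed.

Lemma parabolicM J u v : parabolic J u -> parabolic J v -> parabolic J (u * v).
Proof.
move=> /parabolicP[lu luJ <-] /parabolicP[lv lvJ <-]; apply/parabolicP.
exists (lu ++ lv); rewrite ?word_prod_cat // => s.
by rewrite mem_cat => /orP[/luJ|/lvJ].
Qed.

Lemma parabolicV J u : parabolic J u -> parabolic J u^-1.
Proof.
move=> /parabolicP[l lJ <-]; apply/parabolicP.
by exists (rev l); rewrite ?word_prod_rev // => s; rewrite mem_rev => /lJ.
Qed.

(** By deletion, t = (t w) w^-1 is a product of two elements of W_J. *)
Lemma parabolic_shortens J w t :
  is_reflection t -> parabolic J w -> shortens t w -> parabolic J t.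
Proof.
move=> tR wJ; have /parabolicP[l lJ lw] := wJ.
rewrite -lw shortens_word // => /word_parity_deletion[l1 [s [l2 [El E]]]].
have -> : t = word_prod (l1 ++ l2) * w^-1 by rewrite -E lw mulgK.
apply: parabolicM; last exact: parabolicV.
apply/parabolicP; exists (l1 ++ l2) => // r; rewrite mem_cat => r12.
by apply: lJ; rewrite El mem_cat inE; case/orP: r12 => ->; rewrite ?orbT.
Qed.

(** A first letter s of u is an inversion of w, so it lies in W_J; strip it from
    both elements and repeat. *)
Lemma parabolic_weak_le J u w : weak_le u w -> parabolic J w -> parabolic J u.
Proof.
move: {2}(length u) (erefl (length u)) => n.
elim: n u w => [|n IHn] u w un uw wJ.
  by rewrite (length_eq0 un); apply: parabolic1.
have [s su] : exists s, shortens (simple s) u.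
  by apply: shortens_exists; apply: contra_eq_neq un => ->; rewrite length1.
have sw := weak_le_shortens uw su.
have sJ := parabolic_shortens (simple_reflection s) wJ sw.
rewrite -[u](simpleKl s); apply: parabolicM => //.
apply: (IHn _ (simple s * w)); last exact: parabolicM.
  by have := length_shortens su; rewrite un; case.
move: uw; rewrite /weak_le invgM simpleV -mulgA simpleKl.
by rewrite (length_shortens su) (length_shortens sw) addSn eqSS.
Qed.

(** Build the word letter by letter: a new letter s that shortens the product
    acts by erasing a letter, which leaves a reduced word over J. *)
Lemma parabolic_reduced_word J w : parabolic J w ->
  exists l, [/\ {subset l <= J}, word_prod l = w & size l = length w].
Proof.
move=> /parabolicP[l lJ <-]; elim: l lJ => [|s l IHl] lJ.
  by exists [::]; rewrite word_prod_nil length1.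
case: IHl => [r rl|l' [l'J l'E l'len]]; first by apply: lJ; rewrite inE rl orbT.
have sJ : s \in J by apply: lJ; rewrite mem_head.
rewrite word_prod_cons -l'E; rewrite -l'E in l'len.
case: (boolP (shortens (simple s) (word_prod l'))) => sl'; last first.
  exists (s :: l'); rewrite word_prod_cons length_simpleM //= l'len.
  by split=> // r; rewrite inE => /orP[/eqP->|/l'J].
have := sl'; rewrite shortens_word; last exact: simple_reflection.
move=> /word_parity_deletion[l1 [r [l2 [El E]]]]; exists (l1 ++ l2).
split=> [q q12|//|].
  apply: l'J; rewrite El mem_cat inE; move: q12; rewrite mem_cat.
  by case/orP=> ->; rewrite ?orbT.
apply/eqP; rewrite -eqSS -(length_shortens sl') -l'len El.
by rewrite !size_cat /= addnS.
Qed.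

(** A reduced word over J for s is a single letter r of J, and r = s because
    distinct generators are distinct in the group. *)
Lemma parabolic_simpleE J s : parabolic J (simple s) -> s \in J.
Proof.
case/parabolic_reduced_word=> l [lJ ls]; rewrite length_simple.
case: l lJ ls => [|r [|]]// lJ; rewrite word_prod_seq1 => /simple_inj<- _.
by apply: lJ; rewrite mem_head.
Qed.

(** Write w = v x with v in W_J and x of minimal length in W_J w.  A reflection
    t of W_J does not shorten x, by minimality, nor does its conjugate by v; the
    cocycle property then says that t shortens w exactly when it shortens
    v. *)
Lemma parabolic_partP J w :
  parabolic J (parabolic_part J w) /\
  inversions (parabolic_part J w) = (inversions w `&` parabolic J)%classic.
Proof.
apply: (xgetPex 1 (P := fun v => parabolic J v /\
  inversions v = (inversions w `&` parabolic J)%classic)).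
have ex_coset_length :
    exists n, `[< exists2 u, parabolic J u & length (u * w) = n >].
  exists (length w); apply/asboolP.
  by exists 1; rewrite ?mul1g //; apply: parabolic1.
(* The shortest element x of the coset is u * w, and v is u^-1. *)
case: (ex_minnP ex_coset_length) => n /asboolP[u uJ ux] xmin.
have x_min t : parabolic J t -> ~~ shortens t (u * w).
  move=> tJ; rewrite /shortens -leqNgt ux; apply: xmin; apply/asboolP.
  by exists (t * u); rewrite ?mulgA //; apply: parabolicM.
have vJ := parabolicV uJ; exists u^-1; split=> //.
have shortens_w t :
    is_reflection t -> parabolic J t -> shortens t w = shortens t u^-1.
  move=> tR tJ; rewrite -[w in LHS](mulKg u) shortensM //.
  rewrite (negPf (x_min _ _)) ?addbF //.
  by rewrite conjgE; do !apply: parabolicM => //; apply: parabolicV.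
apply/seteqP; split=> t /=; rewrite /inversions /=.
  case=> tR tv; have tJ := parabolic_shortens tR vJ tv.
  by rewrite -/(shortens t w) shortens_w.
case=> [[tR]]; rewrite -/(shortens t w) => tw tJ.
by split=> //; rewrite -/(shortens _ _) -shortens_w.
Qed.

Lemma parabolic_part_parabolic J w : parabolic J (parabolic_part J w).
Proof. by have [] := parabolic_partP J w. Qed.

Lemma parabolic_part_le J w : weak_le (parabolic_part J w) w.
Proof.
apply: shortens_weak_le => t tR tv.
have : inversions (parabolic_part J w) t by [].
by have [_ ->] := parabolic_partP J w; case=> [[]].
Qed.

(** So [parabolic_part J w] is the largest element of W_J below w. *)
Lemma weak_le_parabolic_part J u w :
  parabolic J u -> weak_le u w -> weak_le u (parabolic_part J w).
Proof.
move=> uJ uw; apply: shortens_weak_le => t tR tu.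
suff : inversions (parabolic_part J w) t by case.
have [_ ->] := parabolic_partP J w; split; last exact: parabolic_shortens tu.
by split=> //; apply: weak_le_shortens tu.
Qed.

Lemma parabolic_part_id J w : parabolic J w -> parabolic_part J w = w.
Proof.
move=> wJ; apply: weak_le_anti; first exact: parabolic_part_le.
exact/weak_le_parabolic_part/weak_le_refl.
Qed.

End Parabolic.

(** * Acyclic sets and their Coxeter elements *)

Section CoxeterElements.
Local Open Scope group_scope.
Variables (W : coxeter_system) (Omega : rel (cox_gen W)).
Notation S := (cox_gen W).
Implicit Types (u v w x t : W) (s r : S) (l : seq S) (J : {set S}).

(** For w != 1 the recursion reads pi(w) = head w * pi(tail w). *)
Local Notation maxJ w := (max_acyclic Omega w).
Local Notation head w := (cox_elt Omega (maxJ w)).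
Local Notation tail w := ((head w)^-1 * parabolic_part (maxJ w) w).

(** A word without repetition is reduced: its first letter s does not shorten
    the rest, since it would then lie in the parabolic subgroup of the other
    letters.  So s is an inversion of the product, hence an element of W_J. *)
Lemma uniq_word_support J l :
  uniq l -> parabolic J (word_prod l) -> {subset l <= J}.
Proof.
have uniq_shortens s k : s \notin k -> ~~ shortens (simple s) (word_prod k).
  apply: contra => sk; have : parabolic [set r in k] (simple s).
    apply: parabolic_shortens sk; first exact: simple_reflection.
    by apply/parabolicP; exists k => // r; rewrite inE.
  by move/parabolic_simpleE; rewrite inE.
elim: l => [|s l IHl] //= /andP[sl ul]; rewrite word_prod_cons => slJ.
have sJ : parabolic J (simple s).
  apply: parabolic_shortens slJ _; first exact: simple_reflection.
  by rewrite shortens_simpleM uniq_shortens.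
have lJ : parabolic J (word_prod l).
  by rewrite -[word_prod l](simpleKl s); apply: parabolicM.
move=> r; rewrite inE => /orP[/eqP->|]; first exact: parabolic_simpleE.
exact: IHl.
Qed.

Lemma acyclic_subset J J' : J' \subset J -> acyclic Omega J -> acyclic Omega J'.
Proof.
by move=> /fintype.subsetP sub acJ c c0 cJ'; apply: acJ => // s /cJ'/sub.
Qed.

(** Take s reaching as few elements of J as possible.  A successor r of s
    reaches s back, otherwise it would reach fewer elements; a simple path from
    r to s then closes up into a cycle. *)
Lemma acyclic_sink J : acyclic Omega J -> J != finset.set0 ->
  exists2 s, s \in J & {in J, forall r, ~~ Omega s r}.
Proof.
move=> acJ /finset.set0Pn[s0 s0J].
pose e : rel S := [rel s r | [&& s \in J, r \in J & Omega s r]].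
case: (arg_minnP (fun s => #|connect e s|) s0J) => s sJ smin.
exists s => // r rJ; apply/negP => Osr.
have esr : e s r by apply/and3P.
have nrs : ~~ connect e r s.
  apply/negP => /connectP[p0 pe0 s_last].
  move: s_last; case/shortenP: pe0 => p pe pu _ s_last.
  have pJ : {subset r :: p <= J}.
    move=> q; rewrite inE => /orP[/eqP->//|qp].
    elim: (p) (r) pe qp => //= y p' IHp x /andP[/and3P[_ yJ _] py].
    by rewrite inE => /orP[/eqP->//|]; apply: IHp py.
  have /negP := acJ (r :: p) isT pJ; apply.
  rewrite /ucycleb pu andbT /= rcons_path -s_last Osr andbT.
  by apply: sub_path pe => x y /and3P[].
have := smin r rJ; rewrite leqNgt => /negP; apply.
apply/proper_card/fintype.properP; split; last by exists s; [exact: connect0|].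
by apply/fintype.subsetP => q; apply: connect_trans; apply: connect1.
Qed.

(** Topological sorting: a sink comes first, as an edge t -> s puts s before
    t. *)
Lemma admissible_ordering_exists J :
  acyclic Omega J -> exists l, admissible_ordering Omega J l.
Proof.
move: {2}#|J| (erefl #|J|) => n; elim: n J => [|n IHn] J Jn acJ.
  exists [::]; rewrite (cards0_eq Jn); split=> // [s|s r]; by rewrite !inE.
have J0 : J != finset.set0 by rewrite -card_gt0 Jn.
have [s sJ sink] := acyclic_sink acJ J0.
have [||l [ul lJ lO]] := IHn (J :\ s).
- by apply/eqP; rewrite -eqSS -Jn (cardsD1 s J) sJ.
- by apply: acyclic_subset acJ; apply: finset.subD1set.
exists (s :: l); split=> [|r|r q rJ qJ Oqr].
- by rewrite /= ul andbT lJ !inE eqxx.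
- by rewrite inE lJ !inE; case: eqVneq => [->|].
have qs : s != q by apply: contraTneq Oqr => <-; apply: sink.
rewrite /= (negPf qs); case: eqVneq => // rs.
by rewrite ltnS lO // !inE eq_sym ?rs ?qs.
Qed.

Lemma cox_elt_word J : acyclic Omega J ->
  exists l, [/\ uniq l, l =i J & cox_elt Omega J = word_prod l].
Proof.
move=> /admissible_ordering_exists/(xgetPex [::])[ul lJ _].
by exists (xget [::] (admissible_ordering Omega J)).
Qed.

Lemma parabolic_cox_elt J : acyclic Omega J -> parabolic J (cox_elt Omega J).
Proof.
move=> /cox_elt_word[l [_ lJ ->]].
by apply/parabolicP; exists l => // s; rewrite lJ.
Qed.

Lemma cox_elt_support J J' :
  acyclic Omega J' -> parabolic J (cox_elt Omega J') -> J' \subset J.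
Proof.
move=> /cox_elt_word[l [ul lJ' ->]] /(uniq_word_support ul) lJ.
by apply/fintype.subsetP => s; rewrite -lJ' => /lJ.
Qed.

Lemma cox_elt_eq1 J : acyclic Omega J -> cox_elt Omega J = 1 -> J = finset.set0.
Proof.
move=> acJ c1; apply/eqP; rewrite -finset.subset0.
by apply: cox_elt_support => //; rewrite c1; apply: parabolic1.
Qed.

Lemma acyclic_set0 : acyclic Omega finset.set0.
Proof. by case=> [|s c] // _ /(_ s); rewrite mem_head inE => /(_ isT). Qed.

Lemma max_acyclicP w :
  [/\ acyclic Omega (maxJ w), weak_le (head w) w &
      forall J, acyclic Omega J -> weak_le (cox_elt Omega J) w ->
        maxJ w \subset J -> J = maxJ w].
Proof.
pose P J' := `[< acyclic Omega J' >] && weak_le (cox_elt Omega J') w.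
have P0 : P finset.set0.
  apply/andP; split; first by apply/asboolP/acyclic_set0.
  have [l [_ l0 ->]] := cox_elt_word acyclic_set0.
  case: l l0 => [_|s l /(_ s)]; last by rewrite mem_head inE.
  by rewrite word_prod_nil /weak_le length1 invg1 mul1g.
have /maxsetP[/andP[/asboolP acJ cJ] J_max] : maxset P (maxJ w).
  have [J0 J0max] := ex_maxset (ex_intro P _ P0).
  by apply: (xgetPex _ (P := fun J => maxset P J)); exists J0.
split=> // J acJ' cJ' JJ'; apply: J_max => //.
by rewrite /P cJ' andbT; apply/asboolP.
Qed.

(** * The downward projection *)

Hypothesis Omega_irr : irreflexive Omega.

Lemma acyclic_set1 s : acyclic Omega [set s]%SET.
Proof.
move=> [|r [|q c]] // _ sub; rewrite /ucycleb /= ?Omega_irr //.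
have := sub r; have := sub q; rewrite !inE !eqxx !orbT.
by move=> /(_ isT)/eqP-> /(_ isT)/eqP->; rewrite eqxx andbF.
Qed.

Lemma max_acyclic_neq0 w : w != 1 -> max_acyclic Omega w != finset.set0.
Proof.
case: (max_acyclicP w) => _ _ max_max.
move=> /shortens_exists[s sw]; apply/eqP => J0.
have acs := @acyclic_set1 s.
suff /(max_max _ acs) : weak_le (cox_elt Omega [set s]%SET) w.
  rewrite J0 finset.sub0set => /(_ isT)/setP/(_ s).
  by rewrite !inE eqxx.
have [l [ul ls ->]] := cox_elt_word acs.
have -> : l = [:: s].
  apply: perm_small_eq => //; apply: uniq_perm => // r.
  by rewrite ls !inE.
rewrite word_prod_seq1 /weak_le length_simple simpleV.
by rewrite (length_shortens sw).
Qed.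

Lemma pi_down_step_le w : weak_le (head w) (parabolic_part (maxJ w) w).
Proof.
have [acJ cw _] := max_acyclicP w.
exact: weak_le_parabolic_part (parabolic_cox_elt acJ) cw.
Qed.

(** The head is nontrivial, because J(w, Omega) contains at least a first letter
    of w. *)
Lemma pi_down_step_length w : w != 1 -> (length (tail w) < length w)%N.
Proof.
move=> w1; have [acJ _ _] := max_acyclicP w.
apply: leq_trans (weak_le_length (parabolic_part_le (maxJ w) w)).
rewrite -(eqP (pi_down_step_le w)) -[X in (X < _)%N]add0n ltn_add2r lt0n.
apply: contraNneq (max_acyclic_neq0 w1) => /length_eq0 c1.
by apply/eqP/(cox_elt_eq1 acJ).
Qed.

Lemma pi_down_rec_fuel n m w : (length w <= n)%N -> (length w <= m)%N ->
  pi_down_rec Omega n w = pi_down_rec Omega m w.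
Proof.
elim: n m w => [|n IHn] [|m] w //=.
- by rewrite leqn0 => /eqP/length_eq0->; rewrite eqxx.
- by move=> _; rewrite leqn0 => /eqP/length_eq0->; rewrite eqxx.
case: eqVneq => // w1 wn wm; congr (_ * _).
by apply: IHn; rewrite -ltnS (leq_trans (pi_down_step_length w1)).
Qed.

Lemma pi_down1 : pi_down Omega 1 = 1.
Proof. by rewrite /pi_down length1. Qed.

Lemma pi_downE w : w != 1 -> pi_down Omega w = head w * pi_down Omega (tail w).
Proof.
move=> w1; have lt := pi_down_step_length w1.
rewrite {1}/pi_down (@pi_down_rec_fuel _ (length w).+1) //= (negPf w1).
by congr (_ * _); apply: pi_down_rec_fuel => //; apply: ltnW.
Qed.

Lemma length_ind (P : W -> Prop) :
  (forall w, (forall x, (length x < length w)%N -> P x) -> P w) ->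
  forall w, P w.
Proof.
move=> IH w; have [n] := ubnP (length w); elim: n w => // n IHn w wn.
by apply: IH => x xw; apply: IHn; apply: leq_trans xw _.
Qed.

(** The lengths of the head and the tail of w add up in w_J, so prefixing the
    head preserves the inequality given by induction for the tail. *)
Lemma pi_down_le w : weak_le (pi_down Omega w) w.
Proof.
elim/length_ind: w => w IHw; case: (eqVneq w 1) => [->|w1].
  by rewrite pi_down1 weak_le_refl.
have le_x := IHw _ (pi_down_step_length w1); have cw := pi_down_step_le w.
rewrite (pi_downE w1); set J := max_acyclic _ _ in le_x cw *.
set c := cox_elt _ _ in le_x cw *; set x := c^-1 * _ in le_x *.
have cxE : c * x = parabolic_part J w by rewrite mulVKg.
rewrite -cxE in cw; have [_ le_cx] := weak_le_mull cw le_x.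
by apply: weak_le_trans le_cx _; rewrite cxE; apply: parabolic_part_le.
Qed.

(** The element v = pi(w) lies between c and w_J in the weak order, which forces
    J(v, Omega) = J(w, Omega) and v_J = v: the recursion for v starts with the
    same c and continues with pi(x) instead of x. *)
Lemma pi_down_idem w : pi_down Omega (pi_down Omega w) = pi_down Omega w.
Proof.
elim/length_ind: w => w IHw; case: (eqVneq w 1) => [->|w1].
  by rewrite !pi_down1.
have [acJ _ _] := max_acyclicP w.
have lt := pi_down_step_length w1; have cw := pi_down_step_le w.
rewrite (pi_downE w1); set J := max_acyclic _ _ in acJ lt cw *.
set c := cox_elt _ _ in lt cw *; set x := c^-1 * _ in lt *.
have cx : weak_le c (c * x) by rewrite mulVKg.
have [cv vx] := weak_le_mull cx (pi_down_le x).
have [v vE] : exists v, v = c * pi_down Omega x by exists (c * pi_down Omega x).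
rewrite -vE in cv vx *.
have vJ : parabolic J v.
  apply: parabolic_weak_le vx _; rewrite mulVKg.
  exact: parabolic_part_parabolic.
have J_v : max_acyclic Omega v = J.
  have [acJ' cJ' J'_max] := max_acyclicP v; apply/esym/(J'_max _ acJ cv).
  exact: cox_elt_support acJ' (parabolic_weak_le cJ' vJ).
have v1 : v != 1.
  apply: contraNneq (max_acyclic_neq0 w1) => v1; rewrite -/J.
  move: cv; rewrite v1 => /weak_le_length; rewrite length1 leqn0.
  by move=> /eqP/length_eq0/(cox_elt_eq1 acJ)/eqP.
by rewrite (pi_downE v1) J_v -/c parabolic_part_id // {1}vE mulKg IHw.
Qed.

End CoxeterElements.

Theorem proposition1p3 (W : coxeter_system) (Omega : rel (cox_gen W))
  (hOmega : orientation Omega) :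
  idempotent_fun (pi_down Omega).
Proof.
have Omega_irr : irreflexive Omega.
  by move=> s; have [_ /(_ s s)] := hOmega; rewrite andbb => /negPf.
by move=> w; apply: pi_down_idem.
Qed.
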